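(* Let $\mathcal{S}=\{S(t,s):t\ge s\}\subset\mathcal{L}(X)$ be a continuous linear evolution process that admits a nonuniform exponential dichotomy with bound $K(s)=De^{\nu|s|}$ and exponent $\alpha>\nu$, and assume $$L_{\mathcal{S}}(\nu):=\sup_{0\le t-s\le1}\{e^{-\nu|t|}\|S(t,s)\|_{\mathcal{L}(X)}\}<+\infty.$$ Then there exists $\epsilon>0$ such that if $\mathcal{T}=\{T(t,s):t\ge s\}$ is a continuous linear evolution process with $$\sup_{0\le t-s\le1}\{K(t)\|S(t,s)-T(t,s)\|_{\mathcal{L}(X)}\}<\epsilon,$$ then $L_{\mathcal{T}}(\nu):=\sup_{0\le t-s\le1}\{e^{-\nu|t|}\|T(t,s)\|\}<\infty$ and $\mathcal{T}$ admits a nonuniform exponential dichotomy with exponent $\hat\alpha:=\tilde\alpha-\nu>0$ and bound $$\hat K(s)=\tilde D^2e^{2\tilde\alpha}\max\{L_{\mathcal{T}}(\nu),L_{\mathcal{T}}(\nu)^2\}\,e^{2\nu|s|},$$ where $\tilde\alpha=-\ln\big(\cosh\alpha-[\cosh^2\alpha-1-2\epsilon\sinh\alpha]^{1/2}\big)$, $\rho=\epsilon(1+e^{-\alpha})/(1-e^{-\alpha})$, $\tilde\beta=\tilde\alpha+\ln(1+2\epsilon\sinh\alpha)$, $D_1=[1-\epsilon e^{-\alpha}/(1-e^{-\alpha-\tilde\alpha})]^{-1}$, $D_2=[1-\epsilon e^{-\tilde\beta}/(1-e^{-\alpha-\tilde\beta})]^{-1}$, and $\tilde D=D\big(1+\e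psilon/((1-\rho)(1-e^{-\alpha}))\big)\max\{D_1,D_2\}$.
   Context: A continuous evolution process in a Banach space $X$ is a family $\{S(t,s): t\ge s\}$ of continuous maps $X\to X$ with $S(t,t)=Id_X$, $S(t,s)S(s,\tau)=S(t,\tau)$ for $t\ge s\ge\tau$, and $(t,s,x)\mapsto S(t,s)x$ continuous on $\{t\ge s\}\times X$; it is linear if each $S(t,s)\in\mathcal{L}(X)$. A linear evolution process admits a nonuniform exponential dichotomy if there is a family of bounded projections $\{Q(t)\}_{t\in\mathbb{R}}$ with: (i) $Q(t)S(t,s)=S(t,s)Q(s)$ for $t\ge s$; (ii) $S(t,s)|_{R(Q(s))}:R(Q(s))\to R(Q(t))$ is an isomorphism for $t\ge s$, with inverse denoted $S(s,t)$; (iii) there are a continuous $K:\mathbb{R}\to[1,\infty)$ (bound) with $K(s)\le De^{\nu|s|}$ for constants $D\ge1$, $\nu\ge0$, and $\alpha>0$ (exponent) with $\|S(t,s)(Id_X-Q(s))\|\le K(s)e^{-\alpha(t-s)}$ for $t\ge s$ and $\|S(t,s)Q(s)\|\le K(s)e^{\alpha(t-s)}$ for $t<s$. *)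

(* Defs.v *)
From HB Require Import structures.
From mathcomp Require Import all_boot all_order all_algebra.
From mathcomp Require Import all_classical all_reals all_analysis.
Set Implicit Arguments. Unset Strict Implicit. Unset Printing Implicit Defensive.
Import Order.TTheory GRing.Theory Num.Theory.
Import numFieldNormedType.Exports.
Local Open Scope classical_set_scope.
Local Open Scope ring_scope.

(* An evolution "process" is given as a two-parameter family S t s : X -> X;
   only its values for t >= s are meaningful. *)

Definition evolution_process (R : realType) (X : normedModType R)
  (S : R -> R -> X -> X) : Prop :=
  (forall t x, S t t x = x) /\
  (forall t s tau x, s <= t -> tau <= s -> S t s (S s tau x) = S t tau x) /\
  {within [set p : (R * R) * X | p.1.2 <= p.1.1],
     continuous (fun p : (R * R) * X => S p.1.1 p.1.2 p.2)}.

Definition linear_map (R : realType) (X : normedModType R) (A : X -> X) : Prop :=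
  forall (a : R) (x y : X), A (a *: x + y) = a *: A x + A y.

Definition linear_evolution_process (R : realType) (X : normedModType R)
  (S : R -> R -> X -> X) : Prop :=
  evolution_process S /\ (forall t s, s <= t -> linear_map (S t s)).

Definition opnorm (R : realType) (X : normedModType R) (A : X -> X) : R :=
  sup [set r | exists x : X, `|x| <= 1 /\ r = `|A x|].

Definition Lset (R : realType) (X : normedModType R)
  (S : R -> R -> X -> X) (nu : R) : set R :=
  [set r | exists t s : R, 0 <= t - s <= 1 /\
     r = expR (- (nu * `|t|)) * opnorm (S t s)].

Definition L_of (R : realType) (X : normedModType R)
  (S : R -> R -> X -> X) (nu : R) : R := sup (Lset S nu).

Definition nonuniform_exp_dichotomy (R : realType) (X : normedModType R)
  (S : R -> R -> X -> X) (K : R -> R) (alpha : R) : Prop :=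
  0 < alpha /\ continuous K /\ (forall s, 1 <= K s) /\
  (exists D nu : R, 1 <= D /\ 0 <= nu /\ forall s, K s <= D * expR (nu * `|s|)) /\
  exists Q : R -> X -> X,
    (forall t, linear_map (Q t) /\ continuous (Q t) /\
               forall x, Q t (Q t x) = Q t x) /\
    (forall t s x, s <= t -> Q t (S t s x) = S t s (Q s x)) /\
    (forall t s y, s <= t -> (exists z, y = Q t z) ->
       exists x, (exists z, x = Q s z) /\ S t s x = y /\
         forall x', (exists z, x' = Q s z) -> S t s x' = y -> x' = x) /\
    (forall t s x, s <= t ->
       `|S t s (x - Q s x)| <= K s * expR (- (alpha * (t - s))) * `|x|) /\
    (* ||S(t,s) Q(s)|| <= K(s) e^{alpha(t-s)} for t < s, where S(t,s) is
       the inverse of S(s,t) : R(Q t) -> R(Q s); S(t,s)Q(s)x is the y in R(Q t)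
       with S(s,t) y = Q(s) x *)
    (forall t s x y, t < s -> (exists z, y = Q t z) -> S s t y = Q s x ->
       `|y| <= K s * expR (alpha * (t - s)) * `|x|).

Definition cosh (R : realType) (x : R) : R := (expR x + expR (- x)) / 2.
Definition sinh (R : realType) (x : R) : R := (expR x - expR (- x)) / 2.

(* Main.v *)
(** Put [a = e^-alpha] and work on each lattice [s + Z].  There the dichotomy of
    [S] makes [y_n = S_n y_(n-1) + f_n] uniquely solvable among bounded
    sequences, with a Green kernel bounded by [K a^|n|]; since the weight [K] is
    absorbed by the smallness of [T - S], the equation for [T] is a contraction
    with factor [rho < 1] and inherits unique bounded solvability.  Solving it
    with a source [x] at time [s] only, the value at [s] is the stable component
    of [x], which defines the projection.

    The number [z = e^-alpha_t] is the smaller root of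
    [eps (1 - a^2) = (z - a) (1 - a z)].  We choose [z] first, slightly larger
    than [a], and let this equation define [eps].  With it,
    [(1 - a^2) / (1 - z^2) * z^|n|] is an explicit supersolution of the scalar
    majorant equation, which gives the exact rate [z].

    Stable and unstable vectors at [s] are those with a bounded forward, resp.
    backward, orbit on [s + Z].  They decay at rate [z < e^-nu], which beats the
    growth [L_T e^(nu |t|)] over unit steps, so both notions are carried from one
    lattice to another by [T], and the discrete estimates extend to all real
    times at the cost of [e^(nu |t|) <= e^(nu |s|) e^(nu |t - s|)]. *)

Require Import Defs.
From HB Require Import structures.
From mathcomp Require Import all_boot all_order all_algebra.
From mathcomp Require Import all_classical all_reals all_analysis.
From mathcomp Require Import ring lra zify.
Set Implicit Arguments.
Unset Strict Implicit.
Unset Printing Implicit Defensive.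
Import Order.TTheory GRing.Theory Num.Theory.
Import numFieldNormedType.Exports.
Local Open Scope classical_set_scope.
Local Open Scope ring_scope.


(** * Bounded linear maps and the operator norm *)

Section LinearMaps.
Variables (R : realType) (X : normedModType R).
Implicit Types (f : X -> X) (x y : X).

Lemma linear_mapP {f} : linear_map f -> exists g : {linear X -> X}, f = g.
Proof.
move=> fl.
by exists (HB.pack_for {linear X -> X} f (GRing.isLinear.Build R X X *:%R f fl)).
Qed.

Lemma linear_map0 {f} : linear_map f -> f 0 = 0.
Proof. by move=> /linear_mapP[g ->]; rewrite linear0. Qed.

Lemma linear_mapB {f} : linear_map f -> {morph f : x y / x - y}.
Proof. by move=> /linear_mapP[g ->] x y; rewrite linearB. Qed.

Lemma linear_mapN {f} : linear_map f -> {morph f : x / - x}.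
Proof. by move=> /linear_mapP[g ->] x; rewrite linearN. Qed.

Lemma linear_mapZ {f} : linear_map f -> forall a, {morph f : x / a *: x}.
Proof. by move=> /linear_mapP[g ->] a x; rewrite linearZ. Qed.

Lemma linear_map_bounded {f} : linear_map f -> continuous f ->
  exists2 M, 0 < M & forall x, `|f x| <= M * `|x|.
Proof.
move=> /linear_mapP[g ->] /linear_bounded_continuous/linear_boundedP gb.
near (+oo : set_system R) => M.
exists M; first by near: M; exact: nbhs_pinfty_gt.
by near: M.
Unshelve. all: by end_near. Qed.

Lemma bounded_linear_map_continuous {f} M : linear_map f ->
  (forall x, `|f x| <= M * `|x|) -> continuous f.
Proof.
move=> /linear_mapP[g ->] gM; apply/linear_bounded_continuous/linear_boundedP.
near=> r => x; apply: le_trans (gM x) _.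
by rewrite ler_wpM2r//; near: r; exact: nbhs_pinfty_ge.
Unshelve. all: by end_near. Qed.

Lemma opnorm_ge0 f : 0 <= opnorm f.
Proof.
rewrite /opnorm; set A := [set r | _].
(* The supremum of an unbounded set is 0 by convention, so that case needs its own branch. *)
have [ubA|nubA] := pselect (has_ubound A); last first.
  by rewrite sup_out// => -[].
apply: le_trans (ub_le_sup ubA _); first exact: normr_ge0 (f 0).
by exists 0; rewrite normr0.
Qed.

Lemma opnorm_le f M : 0 <= M -> (forall x, `|f x| <= M * `|x|) ->
  opnorm f <= M.
Proof.
move=> M0 fM; apply: ge_sup.
  by exists `|f 0|, 0; rewrite normr0.
by move=> _ [x [x1 ->]]; apply: le_trans (fM x) _; rewrite ler_piMr.
Qed.

Lemma opnormP {f} : linear_map f -> continuous f ->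
  forall x, `|f x| <= opnorm f * `|x|.
Proof.
move=> fl fc x; have [->|x0] := eqVneq x 0.
  by rewrite linear_map0// normr0 mulr0.
have nx0 : 0 < `|x| by rewrite normr_gt0.
rewrite -ler_pdivrMr//.
have [M M0 fM] := linear_map_bounded fl fc.
have -> : `|f x| / `|x| = `|f (`|x|^-1 *: x)|.
  by rewrite linear_mapZ// normrZ normfV normr_id mulrC.
apply: ub_le_sup.
  exists M => _ [y [y1 ->]]; apply: le_trans (fM y) _.
  by rewrite ler_piMr// ltW.
by exists (`|x|^-1 *: x); rewrite normrZ normfV normr_id mulVf ?gt_eqF.
Qed.

Lemma opnorm_id_ge1 f : (exists x : X, x != 0) -> (forall x, f x = x) ->
  1 <= opnorm f.
Proof.
move=> [x x0] fid.
have fl : linear_map f by move=> a u v; rewrite !fid.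
have fc : continuous f.
  by apply: (@bounded_linear_map_continuous f 1) => // u; rewrite fid mul1r.
have := opnormP fl fc x; rewrite fid -{1}[`|x|]mul1r ler_pM2r// normr_gt0//.
Qed.

Lemma process_linear (T : R -> R -> X -> X) t s :
  linear_evolution_process T -> s <= t -> linear_map (T t s).
Proof. by move=> [_ Tl]; exact: Tl. Qed.

Lemma process_continuous (T : R -> R -> X -> X) t s :
  linear_evolution_process T -> s <= t -> continuous (T t s).
Proof.
move=> [[_ [_ /subspace_continuousP Tc]] _] st x.
have /= Tx := Tc ((t, s), x) st.
apply: (@cvg_comp _ _ _ (fun y : X => ((t, s), y))
  (fun p : (R * R) * X => T p.1.1 p.1.2 p.2) _ _ _ _ Tx).
(* The slice through [(t, s)] stays in the domain [s <= t], so continuity within the domain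
   restricts to plain continuity in [x]. *)
move=> A [[B C] [/= Bts Cx] BCA].
apply: filterS Cx => y Cy; apply: (BCA ((t, s), y)) => //.
by split=> //=; exact: nbhs_singleton.
Qed.

End LinearMaps.

(** * Geometric convergence *)

Section GeometricLimits.
Variable R : realType.

(** The telescoping series of increments converges absolutely, hence converges by completeness. *)
Lemma geometric_cvg (X : completeNormedModType R) (u : nat -> X) (C q : R) :
  0 <= q -> q < 1 -> (forall j, `|u j.+1 - u j| <= C * q ^+ j) ->
  exists l : X, u @ \oo --> l.
Proof.
move=> q0 q1 uC; pose v := telescope u.
have cv : cvgn (series v).
  apply: normed_cvg.
  apply: (@series_le_cvg _ _ (geometric C q)) => [n|n|n|].
  - exact: normr_ge0.
  - by apply: le_trans (uC n); exact: normr_ge0.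
  - exact: uC.
  - by apply: is_cvg_geometric_series; rewrite ger0_norm.
have uE : u = (fun n => series v n + u 0%N).
  by apply/funext => n; rewrite /v telescopeK subrK.
by exists (limn (series v) + u 0%N); rewrite [X in X @ _]uE; exact: (cvgD cv (cvg_cst _)).
Qed.

Lemma norm_lim_le (X : normedModType R) (u : nat -> X) (l : X) (M : R) :
  u @ \oo --> l -> (forall n, `|u n| <= M) -> `|l| <= M.
Proof.
move=> ul uM; apply: (cvgr_to_le (cvg_norm ul)); exact: nearW.
Qed.

Lemma le_geometric_le0 (c C q : R) : 0 <= q -> q < 1 ->
  (forall j : nat, c <= C * q ^+ j) -> c <= 0.
Proof.
move=> q0 q1 cq; have g : geometric C q @ \oo --> 0.
  by apply: cvg_geometric; rewrite ger0_norm.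
by apply: (cvgr_to_ge g); exact: nearW.
Qed.

End GeometricLimits.

(** The left side is [rho] once [eps] is expressed through [z]. It equals
    [(z - a) (1 - a z) / (1 - a)^2], and denominator minus numerator factors with the positive
    factor [1 - z]. *)
Lemma contraction_factor_lt1 (R : realType) (a z : R) : 0 < a -> a < z -> z < 1 ->
  (z - a) * (1 - a * z) / (1 - a ^+ 2) * (1 + a) / (1 - a) < 1.
Proof.
move=> a0 az z1; have a1 : a < 1 by exact: lt_trans z1.
have aa : 0 < 1 - a ^+ 2 by rewrite subr_gt0 expr_lt1// ltW.
have aa' : 0 < 1 - a by rewrite subr_gt0.
have -> : (z - a) * (1 - a * z) / (1 - a ^+ 2) * (1 + a) / (1 - a) =
    (z - a) * (1 - a * z) / (1 - a) ^+ 2.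
  by field; rewrite (gt_eqF aa) gt_eqF.
rewrite ltr_pdivrMr ?mul1r ?exprn_gt0//.
have -> : (1 - a) ^+ 2 =
    (z - a) * (1 - a * z) + (1 - z) * ((1 - a) ^+ 2 + a * (1 - z)) by ring.
rewrite ltrDl; apply: mulr_gt0; first by rewrite subr_gt0.
by apply: addr_gt0; [rewrite exprn_gt0|rewrite mulr_gt0// subr_gt0].
Qed.

Lemma PoszSB1 p : Posz p.+1 - 1 = p. Proof. by lia. Qed.
Lemma PoszD1 p : Posz p + 1 = p.+1. Proof. by lia. Qed.
Lemma NegzB1 p : Negz p - 1 = Negz p.+1. Proof. by lia. Qed.
Lemma NegzSD1 p : Negz p.+1 + 1 = Negz p. Proof. by lia. Qed.

(** * Bounded solutions of difference equations and their perturbation *)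

Section DiscreteSolutions.
Variables (R : realType) (X : completeNormedModType R).
Implicit Types (A B : int -> X -> X) (f y : int -> X) (k U V r : int -> R).

Definition bounded_solution A f y :=
  (exists M, forall n, `|y n| <= M) /\ forall n, y n = A n (y (n - 1)) + f n.

(* The pair [U], [V] majorizes the convolution of [r] with the two halves of
   the kernel [a ^ |n|]; stating this through one-step inequalities avoids
   summing any series explicitly. *)
Definition admissible A k (a : R) :=
  (forall y, bounded_solution A (fun=> 0) y -> forall n, y n = 0) /\
  (forall f r U V N, (forall n, k n * `|f n| <= r n) ->
    (forall n, 0 <= U n) -> (forall n, 0 <= V n) ->
    (forall n, U n + V n <= N) ->
    (forall n, r n + a * U (n - 1) <= U n) ->
    (forall n, a * (r (n + 1) + V (n + 1)) <= V n) ->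
    exists y, bounded_solution A f y /\ forall n, `|y n| <= U n + V n).

Lemma bounded_solutionB A f g y w : (forall n, linear_map (A n)) ->
  bounded_solution A f y -> bounded_solution A g w ->
  bounded_solution A (fun n => f n - g n) (fun n => y n - w n).
Proof.
move=> Al [[M yM] yE] [[N wN] wE]; split.
  by exists (M + N) => n; apply: le_trans (ler_normB _ _) (lerD _ _).
by move=> n; rewrite {1}yE {1}wE (linear_mapB (Al n)) opprD addrACA.
Qed.

Lemma admissible_unique A k a f y w : (forall n, linear_map (A n)) ->
  admissible A k a -> bounded_solution A f y -> bounded_solution A f w ->
  forall n, y n = w n.
Proof.
move=> Al [Au _] yf wf n; apply/eqP; rewrite -subr_eq0; apply/eqP.
apply: (Au (fun n => y n - w n)).
have := bounded_solutionB Al yf wf.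
rewrite [X in bounded_solution A X](_ : _ = fun=> 0)//.
by apply/funext => m; rewrite subrr.
Qed.

Section Perturbation.
Variables (A B : int -> X -> X) (k : int -> R) (a z : R).
Hypotheses (Al : forall n, linear_map (A n)) (Ac : forall n, continuous (A n)).
Hypotheses (Bl : forall n, linear_map (B n)) (Bc : forall n, continuous (B n)).
Hypotheses (a0 : 0 < a) (az : a < z) (z1 : z < 1).
Hypothesis Aadm : admissible A k a.

Let eps := (z - a) * (1 - a * z) / (1 - a ^+ 2).
Let rho := eps * (1 + a) / (1 - a).

Hypothesis k0 : forall n, 0 <= k n.
Hypothesis kB : forall n x, k n * `|B n x| <= eps * `|x|.

Let a1 : a < 1. Proof. exact: lt_trans az z1. Qed.

Let z0 : 0 < z. Proof. exact: lt_trans az. Qed.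

Let aa : 0 < 1 - a ^+ 2.
Proof. by rewrite subr_gt0 expr_lt1// ltW. Qed.

Let az1 : 0 < 1 - a * z.
Proof. by rewrite subr_gt0 mulr_ilt1// ltW. Qed.

Let eps0 : 0 < eps.
Proof. by rewrite /eps divr_gt0 ?mulr_gt0// subr_gt0. Qed.

Let rho_lt1 : rho < 1.
Proof. exact: contraction_factor_lt1. Qed.

Let rho0 : 0 <= rho.
Proof. by rewrite /rho divr_ge0 ?subr_ge0 ?(ltW a1)// mulr_ge0 ?addr_ge0// ltW. Qed.

(** Admissibility produces some solution with the desired bound; uniqueness identifies it with
    [w]. *)
Lemma perturbation_contracts y w M : (forall n, `|y n| <= M) ->
  bounded_solution A (fun n => B n (y (n - 1))) w ->
  forall n, `|w n| <= rho * M.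
Proof.
move=> yM wy n; have M0 : 0 <= M by exact: le_trans (normr_ge0 _) (yM 0).
have [_ As] := Aadm.
have i0 : 0 <= (1 - a)^-1 by rewrite invr_ge0 subr_ge0 ltW.
have Me0 : 0 <= eps * M by rewrite mulr_ge0// ltW.
(* The constants are [eps * M] times the sums of [a^j] over [j >= 0] and over [j >= 1]. They satisfy
   the one-step inequalities with equality and add up to [rho * M]. *)
have [||||||w' [w'y w'b]] := As (fun n => B n (y (n - 1))) (fun=> eps * M)
  (fun=> eps * M / (1 - a)) (fun=> a * (eps * M) / (1 - a)) (rho * M).
- by move=> m; apply: le_trans (kB _ _) _; rewrite ler_wpM2l// ltW.
- by move=> _; rewrite mulr_ge0.
- by move=> _; rewrite mulr_ge0// mulr_ge0// ltW.
- by move=> _; rewrite le_eqVlt; apply/orP; left; apply/eqP; rewrite /rho; ring.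
- move=> _; rewrite le_eqVlt; apply/orP; left; apply/eqP; field.
  by rewrite gt_eqF// subr_gt0.
- move=> _; rewrite le_eqVlt; apply/orP; left; apply/eqP; field.
  by rewrite gt_eqF// subr_gt0.
rewrite (admissible_unique Al Aadm wy w'y); apply: le_trans (w'b n) _.
by rewrite le_eqVlt; apply/orP; left; apply/eqP; rewrite /rho; ring.
Qed.

(** A homogeneous solution is its own image under the contraction, so its bound [M] improves to
    [M * rho ^+ j] for every [j]. *)
Lemma perturbation_unique y :
  bounded_solution (fun n x => A n x + B n x) (fun=> 0) y -> forall n, y n = 0.
Proof.
move=> [[M yM] yE] n.
have yb j m : `|y m| <= M * rho ^+ j.
  elim: j m => [|j IH] m; first by rewrite mulr1.
  rewrite exprS mulrCA; apply: (@perturbation_contracts y) => //.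
  by split; [exists M|move=> l; rewrite {1}yE addr0].
apply/eqP; rewrite -normr_le0; apply: (@le_geometric_le0 _ _ M rho) => //.
Qed.

Section Source.
Variables (x : X) (c : R).
Hypothesis kx : k 0 * `|x| <= c.
Hypothesis c0 : 0 <= c.

Let src (n : int) : X := if n == 0 then x else 0.
Let h (n : int) : R := c * ((1 - a ^+ 2) / (1 - z ^+ 2)) * z ^+ `|n|%N.

(** Self-mapping property: the fixed-point map for the perturbed equation preserves the set of
    sequences dominated by [h]. *)
Lemma source_majorant y : (forall n, `|y n| <= h n) ->
  exists y', (forall n, `|y' n| <= h n) /\
    bounded_solution A (fun n => src n + B n (y (n - 1))) y'.
Proof.
move=> yh; have [_ As] := Aadm.
have zz : 0 < 1 - z ^+ 2 by rewrite subr_gt0 expr_lt1// ltW.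
pose C := c / (1 - z ^+ 2).
have C0 : 0 <= C by rewrite divr_ge0// ltW.
have cE : c = C * (1 - z ^+ 2) by rewrite /C mulfVK// gt_eqF.
have hE n : h n = C * (1 - a ^+ 2) * z ^+ `|n|%N by rewrite /h /C; ring.
have epsE : eps * (1 - a ^+ 2) = (z - a) * (1 - a * z) by rewrite /eps mulfVK// gt_eqF.
have eh n : eps * h n = C * ((z - a) * (1 - a * z)) * z ^+ `|n|%N.
  by rewrite hE -epsE; ring.
have za0 : 0 <= z - a by rewrite subr_ge0 ltW.
have az0 : 0 <= 1 - a * z by exact: ltW.
(* Up to the factor [C * z^(|n| - 1)], this is the slack in the inequality for [V] at [n < 0]; all
   the other one-step inequalities are equalities. *)
have gap : 0 <= (z - a) * (1 - a ^+ 2) * (1 - z ^+ 2).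
  by apply: mulr_ge0 (ltW zz); exact: mulr_ge0 za0 (ltW aa).
(* For [n >= 0] these are the exact past and future convolution sums; for
   [n < 0] a term [a ^ |n|] has been enlarged to [z ^ |n|] in [V]. *)
pose U (n : int) := C * (if 0 <= n then 1 - a * z else z * (z - a)) * z ^+ `|n|%N.
pose V (n : int) := C *
  (if 0 <= n then a * (z - a) else 1 - a ^+ 2 - z ^+ 2 + a * z) * z ^+ `|n|%N.
have UVE n : U n + V n = h n.
  by rewrite hE /U /V; case: ifP => _; ring.
have U0 n : 0 <= U n.
  apply: mulr_ge0; last by rewrite exprn_ge0 ?ltW.
  apply: mulr_ge0 => //; case: ifP => _ //.
  by rewrite mulr_ge0// ltW.
have V0 n : 0 <= V n.
  apply: mulr_ge0; last by rewrite exprn_ge0 ?ltW.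
  apply: mulr_ge0 => //; case: ifP => _ //.
    by rewrite mulr_ge0// ltW.
  have -> : 1 - a ^+ 2 - z ^+ 2 + a * z =
    (1 - z ^+ 2) * (1 - a ^+ 2) + a * z * (1 - a * z) by ring.
  by rewrite addr_ge0// !mulr_ge0// ltW.
have hN n : h n <= h 0.
  rewrite !hE/= expr0; apply: ler_wpM2l; first by rewrite mulr_ge0// ltW.
  by rewrite exprn_ile1// ltW.
have [||||||y' [y's y'b]] := As (fun n => src n + B n (y (n - 1)))
  (fun n => (if n == 0 then c else 0) + eps * h (n - 1)) U V (h 0).
- move=> n; have : eps * `|y (n - 1)| <= eps * h (n - 1) by rewrite ler_wpM2l// ltW.
  move=> /(le_trans (kB n _)); rewrite /src; case: eqP => [->|_].
    move=> Bh; apply: le_trans (lerD kx Bh).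
    by rewrite -mulrDr ler_wpM2l// ler_normD.
  by rewrite !add0r.
- by [].
- by [].
- by move=> n; rewrite UVE.
(* The cases separate the signs of [n] and [n - 1], which select the branches of [U] and the
   exponents [|n|]. *)
- move=> n; rewrite eh cE /U.
  case: n => [[|p]|p].
  + rewrite /= !expr0 ?expr1.
    by rewrite le_eqVlt; apply/orP; left; apply/eqP; ring.
  + rewrite PoszSB1 /= exprS.
    by rewrite le_eqVlt; apply/orP; left; apply/eqP; ring.
  + rewrite NegzB1 /= !exprS.
    by rewrite le_eqVlt; apply/orP; left; apply/eqP; ring.
- move=> n; rewrite addrK eh cE /V.
  case: n => [p|[|p]].
  + rewrite PoszD1 /= exprS.
    by rewrite le_eqVlt; apply/orP; left; apply/eqP; ring.
  + rewrite /= ?expr1 ?expr0.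
    rewrite -subr_ge0 [leRHS](_ : _ =
      C * ((z - a) * (1 - a ^+ 2) * (1 - z ^+ 2))); last by ring.
    exact: mulr_ge0 C0 gap.
  + rewrite NegzSD1 /= !exprS.
    rewrite -subr_ge0 [leRHS](_ : _ =
      C * ((z - a) * (1 - a ^+ 2) * (1 - z ^+ 2)) * (z * z ^+ p)); last by ring.
    by apply: mulr_ge0; [exact: mulr_ge0 C0 gap|rewrite mulr_ge0 ?exprn_ge0// ltW].
by exists y'; split=> // n; rewrite -UVE.
Qed.

(** Picard iteration from 0: the iterates stay below [h], their differences shrink by [rho] in the
    supremum norm, and the pointwise limit solves the equation. *)
Lemma perturbed_solution : exists y,
  bounded_solution (fun n u => A n u + B n u) src y /\ forall n, `|y n| <= h n.
Proof.
(* Choice needs a total map; sequences not dominated by [h] are sent to themselves and never occur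
   in the iteration. *)
have /choice[Phi PhiP] : forall y, exists y', (forall n, `|y n| <= h n) ->
    (forall n, `|y' n| <= h n) /\
    bounded_solution A (fun n => src n + B n (y (n - 1))) y'.
  move=> y; have [yh|?] := pselect (forall n, `|y n| <= h n); last by exists y.
  by have [y' ?] := source_majorant yh; exists y'.
have h_ge0 n : 0 <= h n.
  apply: mulr_ge0; last by rewrite exprn_ge0 ?ltW.
  apply: mulr_ge0 => //; apply: divr_ge0; first exact: ltW.
  by rewrite subr_ge0 exprn_ile1// ltW.
have hN n : h n <= h 0.
  rewrite /h/= expr0; apply: ler_wpM2l; last by rewrite exprn_ile1// ltW.
  by have := h_ge0 0; rewrite /h/= expr0 mulr1.
pose Y j := iter j Phi (fun=> 0).
have Yh j n : `|Y j n| <= h n.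
  elim: j n => [|j IH] n; first by rewrite normr0.
  exact: (PhiP _ IH).1.
have Ysol j : bounded_solution A (fun n => src n + B n (Y j (n - 1))) (Y j.+1).
  exact: (PhiP _ (Yh j)).2.
have Yinc n j : `|Y j.+1 n - Y j n| <= h 0 * rho ^+ j.
  elim: j n => [|j IH] n.
    by rewrite subr0 mulr1; apply: le_trans (Yh 1%N n) (hN n).
  rewrite exprS mulrCA.
  (* The source cancels in the difference of consecutive iterates, leaving only the perturbation
     term. *)
  apply: (@perturbation_contracts (fun m => Y j.+1 m - Y j m)
    (fun m => Y j.+2 m - Y j.+1 m)) => //.
  have := bounded_solutionB Al (Ysol j.+1) (Ysol j).
  congr (bounded_solution A _ _); apply/funext => m.
  by rewrite (linear_mapB (Bl m)) opprD addrACA subrr add0r.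
have /choice[y Yy] : forall n, exists l : X, (fun j => Y j n) @ \oo --> l.
  by move=> n; apply: geometric_cvg rho0 rho_lt1 (Yinc n).
have yh n : `|y n| <= h n by apply: norm_lim_le (Yy n) _.
exists y; split=> //; split; first by exists (h 0) => n; exact: le_trans (hN n).
move=> n; have YSn m : (fun j => Y j.+1 m) @ \oo --> y m.
  by rewrite (cvg_shiftS (fun j => Y j m)); exact: Yy.
have lim2 : (fun j => A n (Y j.+1 (n - 1)) + (src n + B n (Y j (n - 1)))) @ \oo
    --> A n (y (n - 1)) + (src n + B n (y (n - 1))).
  apply: cvgD; first by apply: continuous_cvg => //; exact: Ac.
  apply: cvgD; first exact: cvg_cst.
  by apply: continuous_cvg => //; exact: Bc.
rewrite -addrA [B n _ + _]addrC; apply: (cvg_unique _ (YSn n)) => //.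
rewrite (_ : (fun j => Y j.+1 n) =
  fun j => A n (Y j.+1 (n - 1)) + (src n + B n (Y j (n - 1))))//.
by apply/funext => j; exact: (Ysol j).2.
Qed.

End Source.
End Perturbation.
End DiscreteSolutions.

(** * Index arithmetic and the lattice of times *)

Lemma absz_shiftB (n : int) (j : nat) : `|(n - j%:Z - n)%R|%N = j.
Proof. by lia. Qed.
Lemma subz_S (n : int) (j : nat) : n - j.+1%:Z = n - 1 - j%:Z.
Proof. by lia. Qed.
Lemma subz_Sr (n : int) (j : nat) : n - j.+1%:Z = n - j%:Z - 1.
Proof. by lia. Qed.
Lemma addz_S (n : int) (j : nat) : n - 1 + 1 + j.+1%:Z = n + 1 + j%:Z.
Proof. by lia. Qed.
Lemma addzBz (n : int) (j : nat) : n + 1 + j%:Z - n = j.+1.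
Proof. by lia. Qed.
Lemma absz_shiftD (n : int) (j : nat) : `|(n + j%:Z - n)%R|%N = j.
Proof. by lia. Qed.

Section Lattice.
Variables (R : realType) (X : Type) (s0 : R).

Definition lattice (n : int) : R := s0 + n%:~R.

(** Steps are indexed by their end time, where the smallness hypothesis on [T - S] evaluates its
    weight. *)
Definition lattice_step (T : R -> R -> X -> X) (n : int) : X -> X :=
  T (lattice n) (lattice (n - 1)).

Lemma lattice_le m n : m <= n -> lattice m <= lattice n.
Proof. by move=> mn; rewrite /lattice lerD2l ler_int. Qed.

Lemma lattice_subn_le n (j : nat) : lattice (n - j%:Z) <= lattice n.
Proof. by apply: lattice_le; lia. Qed.

Lemma lattice_sub1_le n : lattice (n - 1) <= lattice n.
Proof. by apply: lattice_le; lia. Qed.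

Lemma lattice_lt_addn n (j : nat) : lattice n < lattice (n + 1 + j%:Z).
Proof. by rewrite /lattice ltrD2l ltr_int; lia. Qed.

Lemma latticeB m n : lattice m - lattice n = (m - n)%:~R.
Proof. by rewrite /lattice intrB; ring. Qed.

End Lattice.

(** * Admissibility from the dichotomy of the unperturbed process *)

Section LatticeAdmissible.
Variable R : realType.

(** After the term [j = 0] is split off, the rest is [a] times a shorter sum at [n - 1], so
    induction on the length closes with the supersolution inequality. *)
Lemma past_majorant (a : R) (r U : int -> R) : 0 <= a ->
  (forall n, 0 <= U n) -> (forall n, r n + a * U (n - 1) <= U n) ->
  forall N n, \sum_(j < N) a ^+ j * r (n - j%:Z) <= U n.
Proof.
move=> a0 U0 rU; elim=> [|N IH] n; first by rewrite big_ord0.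
rewrite big_ord_recl/= expr0 mul1r subr0; apply: le_trans (rU n).
rewrite lerD2l; under eq_bigr => j _.
  rewrite exprS -mulrA (_ : n - _ = n - 1 - j%:Z); last by rewrite /bump/=; lia.
  over.
by rewrite -mulr_sumr ler_wpM2l.
Qed.

Lemma future_majorant (a : R) (r V : int -> R) : 0 <= a ->
  (forall n, 0 <= V n) -> (forall n, a * (r (n + 1) + V (n + 1)) <= V n) ->
  forall N n, \sum_(j < N) a ^+ j.+1 * r (n + 1 + j%:Z) <= V n.
Proof.
move=> a0 V0 rV; elim=> [|N IH] n; first by rewrite big_ord0.
rewrite big_ord_recl/= expr1 addr0; apply: le_trans (rV n).
rewrite mulrDr lerD2l; under eq_bigr => j _.
  rewrite exprS -mulrA (_ : n + 1 + _ = n + 1 + 1 + j%:Z); last by rewrite /bump/=; lia.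
  over.
by rewrite -mulr_sumr ler_wpM2l.
Qed.

Lemma partial_sums_cvg (X : completeNormedModType R) (g : nat -> X) (C q : R) :
  0 <= q -> q < 1 -> (forall j, `|g j| <= C * q ^+ j) ->
  exists l : X, (fun N => \sum_(j < N) g j) @ \oo --> l.
Proof.
move=> q0 q1 gC; apply: (@geometric_cvg _ _ _ C q) => // j.
by rewrite big_ord_recr/= addrAC subrr add0r.
Qed.

Lemma linear_map_sum (X : normedModType R) (f : X -> X) N (g : 'I_N -> X) :
  linear_map f -> f (\sum_j g j) = \sum_j f (g j).
Proof. by move=> /linear_mapP[h ->]; rewrite linear_sum. Qed.

Variables (X : completeNormedModType R) (S : R -> R -> X -> X) (D nu alpha s0 : R).
Hypotheses (Sp : linear_evolution_process S) (D1 : 1 <= D).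
Hypotheses (nu0 : 0 <= nu) (nualpha : nu < alpha).
Hypothesis Sd : nonuniform_exp_dichotomy S (fun s => D * expR (nu * `|s|)) alpha.

Local Notation tau := (lattice s0).
Let k (n : int) := D * expR (nu * `|tau n|).
Let a := expR (- alpha).

Let D0 : 0 <= D. Proof. exact: le_trans D1. Qed.
Let a0 : 0 <= a. Proof. exact: expR_ge0. Qed.
Let a1 : a < 1. Proof. by rewrite expR_lt1 oppr_lt0; exact: le_lt_trans nualpha. Qed.
Let S_comp t s r x : s <= t -> r <= s -> S t s (S s r x) = S t r x.
Proof. by have [[_ []]] := Sp; move=> + _ _ => /[apply]; exact. Qed.
Let S_id t x : S t t x = x.
Proof. by have [[]] := Sp. Qed.
Let step_linear n : linear_map (lattice_step s0 S n).
Proof. exact: process_linear (lattice_sub1_le s0 n). Qed.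
Let step_continuous n : continuous (lattice_step s0 S n).
Proof. exact: process_continuous (lattice_sub1_le s0 n). Qed.

(** Moving the weight along the lattice costs [e^nu] per step, and [e^nu a < 1] because
    [nu < alpha]. *)
Let k_shift n m : k m * a ^+ `|m - n|%N <= k n * (expR nu * a) ^+ `|m - n|%N.
Proof.
rewrite exprMn mulrA ler_wpM2r ?exprn_ge0//.
rewrite /k -mulrA ler_wpM2l// -expRM_natl -expRD ler_expR.
rewrite [_ * nu]mulrC -mulrDr ler_wpM2l// natr_absz intr_norm -(latticeB s0).
by apply: le_trans (ler_normD _ _); rewrite addrC subrK.
Qed.

Let q_lt1 : expR nu * a < 1.
Proof. by rewrite /a -expRD expR_lt1 subr_lt0. Qed.

Let orbit_iter y : (forall n, y n = lattice_step s0 S n (y (n - 1))) ->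
  forall (j : nat) n, y n = S (tau n) (tau (n - j%:Z)) (y (n - j%:Z)).
Proof.
move=> yE; elim=> [|j IH] n; first by rewrite subr0 S_id.
rewrite {1}IH yE /lattice_step S_comp ?lattice_sub1_le ?lattice_subn_le//.
by rewrite subz_Sr.
Qed.

Let expE n m (j : nat) : tau n - tau m = j%:R ->
  expR (- (alpha * (tau n - tau m))) = a ^+ j.
Proof. by move=> ->; rewrite -expRM_natl mulrN [alpha * _]mulrC. Qed.

Let latticeBn n (j : nat) : tau n - tau (n - j%:Z) = j%:R.
Proof. by rewrite latticeB opprB addrC subrK. Qed.

(** The stable part of [y n] is transported from [j] steps in the past, the unstable part pulled
    back from the future; boundedness of [y] forces both to vanish as the distance grows. *)
Lemma lattice_unique y : bounded_solution (lattice_step s0 S) (fun=> 0) y ->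
  forall n, y n = 0.
Proof.
move=> [[M yM] yE] n.
have {}yE m : y m = lattice_step s0 S m (y (m - 1)) by rewrite yE addr0.
have yI := orbit_iter yE.
have M0 : 0 <= M by exact: le_trans (normr_ge0 _) (yM 0).
have [_ [_ [_ [_ [Q [Qp [QS [_ [St Un]]]]]]]]] := Sd.
have Ps : y n - Q (tau n) (y n) = 0.
  apply/eqP; rewrite -normr_le0.
  apply: (@le_geometric_le0 _ _ (k n * M) (expR nu * a)) => //.
    by rewrite mulr_ge0// expR_ge0.
  move=> j; have le := lattice_subn_le s0 n j.
  rewrite {1 2}(yI j n) QS// -(linear_mapB (process_linear Sp le)).
  apply: le_trans (St _ _ _ le) _.
  rewrite (expE (latticeBn _ _)) [leRHS]mulrAC; apply: ler_pM => //.
    by rewrite !mulr_ge0 ?exprn_ge0 ?expR_ge0.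
  by have := k_shift n (n - j%:Z); rewrite absz_shiftB.
have Qs : Q (tau n) (y n) = 0.
  apply/eqP; rewrite -normr_le0.
  apply: (@le_geometric_le0 _ _ (k n * (expR nu * a) * M) (expR nu * a)) => //.
    by rewrite mulr_ge0// expR_ge0.
  (* The shift is [j.+1] because the unstable estimate holds only for strictly ordered times. *)
  move=> j; have lt : tau n < tau (n + j.+1%:Z).
    by rewrite -[j.+1]add1n PoszD addrA lattice_lt_addn.
  have -> : k n * (expR nu * a) * M * (expR nu * a) ^+ j = k n * (expR nu * a) ^+ j.+1 * M.
    by rewrite exprS; ring.
  have yj : Q (tau (n + j.+1%:Z)) (y (n + j.+1%:Z)) =
      S (tau (n + j.+1%:Z)) (tau n) (Q (tau n) (y n)).
    by rewrite (yI j.+1 (n + j.+1%:Z)) addrK QS// ltW.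
  apply: le_trans (Un _ _ _ _ lt _ (esym yj)) _; first by exists (y n).
  apply: ler_pM => //; first by rewrite !mulr_ge0 ?expR_ge0.
  have := k_shift n (n + j.+1%:Z); rewrite absz_shiftD.
  apply: le_trans; rewrite -(expE (n := n + j.+1%:Z) (m := n)).
    by rewrite -mulrN opprB.
  by rewrite latticeB addrC addKr.
by rewrite -[y n](subrK (Q (tau n) (y n))) Ps Qs addr0.
Qed.

(** Green's formula: the solution is [p n - q n], where [p] sums the stable parts of past sources
    and [q] the unstable parts of future sources pulled back to time [n]. *)
Lemma lattice_solvable f r U V N : (forall n, k n * `|f n| <= r n) ->
    (forall n, 0 <= U n) -> (forall n, 0 <= V n) ->
    (forall n, U n + V n <= N) ->
    (forall n, r n + a * U (n - 1) <= U n) ->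
    (forall n, a * (r (n + 1) + V (n + 1)) <= V n) ->
    exists y, bounded_solution (lattice_step s0 S) f y /\ forall n, `|y n| <= U n + V n.
Proof.
move=> fr U0 V0 UVN rU rV.
have rN n : r n <= N.
  apply: le_trans (UVN n); apply: le_trans (_ : U n <= _); last by rewrite lerDl.
  by apply: le_trans (rU n); rewrite lerDl mulr_ge0.
have [_ [_ [_ [_ [Q [Qp [QS [Qinv [St Un]]]]]]]]] := Sd.
pose g n (j : nat) := S (tau n) (tau (n - j%:Z))
  (f (n - j%:Z) - Q (tau (n - j%:Z)) (f (n - j%:Z))).
have gr n j : `|g n j| <= a ^+ j * r (n - j%:Z).
  apply: le_trans (St _ _ _ (lattice_subn_le s0 _ _)) _.
  rewrite (expE (latticeBn _ _)) mulrAC [leLHS]mulrC.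
  by apply: ler_wpM2l; [rewrite exprn_ge0|exact: fr].
have g0 n : g n 0%N = f n - Q (tau n) (f n) by rewrite /g subr0 S_id.
have gS n j : g n j.+1 = lattice_step s0 S n (g (n - 1) j).
  rewrite /g /lattice_step S_comp ?lattice_sub1_le ?lattice_subn_le//.
  by rewrite subz_S.
(* [W] realizes the inverse of [S] on the ranges of [Q], applied after projection, with default 0
   for wrongly ordered times. *)
have /choice[W WP] : forall tsx : R * R * X, exists y, tsx.1.1 <= tsx.1.2 ->
    (exists w, y = Q tsx.1.1 w) /\ S tsx.1.2 tsx.1.1 y = Q tsx.1.2 tsx.2.
  move=> [[t s] x]/=; have [ts|?] := boolP (t <= s); last by exists 0.
  by have [|y [? [? _]]] := Qinv s t (Q s x) ts; [exists x|exists y].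
have Winj t s y y' : s <= t -> (exists w, y = Q s w) -> (exists w, y' = Q s w) ->
    S t s y = S t s y' -> y = y'.
  move=> st [w yw] [w' yw'] yy'.
  have [|u [_ [_ uu]]] := Qinv t s (S t s y) st.
    by exists (S t s w); rewrite yw QS.
  transitivity u; first by apply: uu => //; exists w.
  by symmetry; apply: uu; [exists w'|rewrite yy'].
(* Future sources start at [n + 1]: the source at [n] enters through its stable part [g n 0], and
   its unstable part appears when [q (n - 1)] is stepped forward. *)
pose e n (j : nat) := W (tau n, tau (n + 1 + j%:Z), f (n + 1 + j%:Z)).
have lt := lattice_lt_addn s0.
have er n j : `|e n j| <= a ^+ j.+1 * r (n + 1 + j%:Z).
  have [/= eQ eS] := WP (tau n, tau (n + 1 + j%:Z), f (n + 1 + j%:Z)) (ltW (lt n j)).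
  apply: le_trans (Un _ _ _ _ (lt n j) eQ eS) _.
  rewrite mulrAC [leLHS]mulrC -(expE (n := n + 1 + j%:Z) (m := n)); last first.
    by rewrite latticeB addzBz.
  by rewrite -mulrN opprB; apply: ler_wpM2l; [exact: expR_ge0|exact: fr].
have e0 n : lattice_step s0 S n (e (n - 1) 0%N) = Q (tau n) (f n).
  have [/= _] := WP (tau (n - 1), tau (n - 1 + 1 + 0%:Z), f (n - 1 + 1 + 0%:Z))
    (ltW (lt (n - 1) 0%N)).
  by rewrite /e /lattice_step addr0 subrK.
have eS n j : lattice_step s0 S n (e (n - 1) j.+1) = e n j.
  have le1 := lattice_sub1_le s0 n.
  have [/= [w ew] eS] := WP (tau n, tau (n + 1 + j%:Z), f (n + 1 + j%:Z)) (ltW (lt n j)).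
  have [/=] := WP (tau (n - 1), tau (n - 1 + 1 + j.+1%:Z), f (n - 1 + 1 + j.+1%:Z))
    (ltW (lt (n - 1) j.+1)).
  rewrite -/(e (n - 1) j.+1) -/(e n j) in ew eS *.
  rewrite addz_S.
  (* Both vectors lie in the range of [Q (tau n)] and have the same image at time [n + 1 + j]. *)
  move=> [w' ew'] eS'; apply: (Winj _ _ _ _ (ltW (lt n j))).
  - by exists (lattice_step s0 S n w'); rewrite ew' /lattice_step QS.
  - by exists w.
  - by rewrite /lattice_step S_comp ?eS ?eS' // ltW.
have /choice[p pP] : forall n, exists l : X, (fun M => \sum_(j < M) g n j) @ \oo --> l.
  move=> n; apply: (@partial_sums_cvg _ _ N a) => // j.
  by apply: le_trans (gr n j) _; rewrite mulrC; apply: ler_wpM2r; rewrite ?exprn_ge0.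
have /choice[q qP] : forall n, exists l : X, (fun M => \sum_(j < M) e n j) @ \oo --> l.
  move=> n; apply: (@partial_sums_cvg _ _ (a * N) a) => // j.
  apply: le_trans (er n j) _; rewrite exprS [leRHS]mulrAC.
  by apply: ler_wpM2l; rewrite ?mulr_ge0 ?exprn_ge0.
have pU n : `|p n| <= U n.
  apply: norm_lim_le (pP n) _ => M; apply: le_trans (ler_norm_sum _ _ _) _.
  by apply: le_trans (past_majorant a0 U0 rU M n); apply: ler_sum => j _; exact: gr.
have qV n : `|q n| <= V n.
  apply: norm_lim_le (qP n) _ => M; apply: le_trans (ler_norm_sum _ _ _) _.
  by apply: le_trans (future_majorant a0 V0 rV M n); apply: ler_sum => j _; exact: er.
have sumS (v : int -> nat -> X) l n : (fun M => \sum_(j < M) v n j) @ \oo --> l ->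
    (fun M => \sum_(j < M.+1) v n j) @ \oo --> l.
  by move=> vl; rewrite (cvg_shiftS (fun M => \sum_(j < M) v n j)).
have pE n : p n = f n - Q (tau n) (f n) + lattice_step s0 S n (p (n - 1)).
  have lim0 : (fun M => \sum_(j < M.+1) g n j) @ \oo --> p n by apply: sumS; exact: pP.
  apply: (cvg_unique _ lim0) => //.
  rewrite (_ : (fun M => _) = (fun M => f n - Q (tau n) (f n) +
      lattice_step s0 S n (\sum_(j < M) g (n - 1) j))); last first.
    apply/funext => M; rewrite big_ord_recl g0 (linear_map_sum _ (step_linear n)).
    by congr (_ + _); apply: eq_bigr => j _; exact: gS.
  apply: cvgD; first exact: cvg_cst.
  by apply: continuous_cvg => //; exact: step_continuous.
have qE n : lattice_step s0 S n (q (n - 1)) = Q (tau n) (f n) + q n.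
  have lim1 : (fun M => lattice_step s0 S n (\sum_(j < M.+1) e (n - 1) j)) @ \oo
      --> lattice_step s0 S n (q (n - 1)).
    by apply: continuous_cvg; [exact: step_continuous|apply: sumS; exact: qP].
  apply: (cvg_unique _ lim1) => //.
  rewrite (_ : (fun M => _) = (fun M => Q (tau n) (f n) +
      \sum_(j < M) e n j)); last first.
    apply/funext => M; rewrite (linear_map_sum _ (step_linear n)) big_ord_recl e0.
    by congr (_ + _); apply: eq_bigr => j _; exact: eS.
  by apply: cvgD => //; exact: cvg_cst.
have pqUV n : `|p n - q n| <= U n + V n.
  by apply: le_trans (ler_normB _ _) (lerD _ _).
exists (fun n => p n - q n); split=> //; split.
  by exists N => n; exact: le_trans (UVN n).
move=> n; rewrite (linear_mapB (step_linear n)) qE {1}pE opprD.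
by rewrite [in RHS]addrC !addrA (addrAC (f n)).
Qed.

Lemma lattice_admissible : admissible (lattice_step s0 S) k a.
Proof. by split; [exact: lattice_unique|exact: lattice_solvable]. Qed.

End LatticeAdmissible.

(** Growth of [T] is controlled over steps of length at most 1; transitive properties reach all
    times by peeling off a last unit step. *)
Lemma unit_step_ind (R : realType) (P : R -> R -> Prop) :
  (forall s t, 0 <= t - s <= 1 -> P s t) ->
  (forall r s t, r <= s -> s <= t -> P r s -> P s t -> P r t) ->
  forall s t, s <= t -> P s t.
Proof.
move=> P1 Ptr s t st.
have [m] : exists m : nat, t - s <= m%:R.
  by exists (Num.truncn (t - s)).+1; rewrite ltW// truncnS_gt.
elim: m s t st => [|m IH] s t st.
  by move=> ts; apply: P1; rewrite subr_ge0 st (le_trans ts).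
have [ts1|ts1] := leP (t - s) 1; first by move=> _; apply: P1; rewrite subr_ge0 st.
rewrite -natr1 => tsm; apply: (Ptr _ (t - 1)); [lra|lra|apply: IH; lra|].
by apply: P1; lra.
Qed.

(** * Stable and unstable subspaces, and passage to real times *)

Section LatticeOrbits.
Variables (R : realType) (X : completeNormedModType R) (T : R -> R -> X -> X).
Variables (nu gamma c L : R).
Hypotheses (Tp : linear_evolution_process T) (nu0 : 0 <= nu) (nugamma : nu < gamma).
Hypotheses (c0 : 0 <= c) (L0 : 0 <= L).
Hypothesis TL : forall t s x, 0 <= t - s <= 1 ->
  `|T t s x| <= L * expR (nu * `|t|) * `|x|.
Hypothesis Tunique : forall s y,
  bounded_solution (lattice_step s T) (fun=> 0) y -> forall n, y n = 0.
Hypothesis Tgreen : forall s x, exists y,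
  bounded_solution (lattice_step s T) (fun n => if n == 0 then x else 0) y /\
  forall n, `|y n| <= c * expR (nu * `|s|) * `|x| * expR (- gamma) ^+ `|n|%N.

Let z := expR (- gamma).
Let C (s : R) := c * expR (nu * `|s|).

Let z0 : 0 <= z. Proof. exact: expR_ge0. Qed.
Let C0 s : 0 <= C s. Proof. by rewrite mulr_ge0 ?expR_ge0. Qed.
Let T_comp t s r x : s <= t -> r <= s -> T t s (T s r x) = T t r x.
Proof. by have [[_ []]] := Tp; move=> + _ _ => /[apply]; exact. Qed.
Let T_id t x : T t t x = x.
Proof. by have [[]] := Tp. Qed.
Let T_lin t s : s <= t -> linear_map (T t s).
Proof. exact: process_linear. Qed.

Definition stable s x := exists M, forall j : nat, `|T (s + j%:R) s x| <= M.

(** The past of [x] is carried as a sequence because [T] need not be invertible. *)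
Definition backward_orbit s x (v : nat -> X) :=
  v 0%N = x /\ forall j, T (s - j%:R) (s - j.+1%:R) (v j.+1) = v j.

Definition unstable s x := exists v, backward_orbit s x v /\
  exists M, forall j, `|v j| <= M.

Let le_addn (s : R) (j : nat) : s <= s + j%:R.
Proof. by rewrite lerDl. Qed.

Let le_subS (s : R) (j : nat) : s - j.+1%:R <= s - j%:R.
Proof. by rewrite lerD2l lerN2 ler_nat. Qed.

Lemma stable_linear s a x y : stable s x -> stable s y -> stable s (a *: x + y).
Proof.
move=> [M xM] [N yN]; exists (`|a| * M + N) => j.
rewrite (T_lin (le_addn s j)); apply: le_trans (ler_normD _ _) (lerD _ _) => //.
by rewrite normrZ ler_wpM2l.
Qed.

Lemma unstable_linear s a x y :
  unstable s x -> unstable s y -> unstable s (a *: x + y).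
Proof.
move=> [v [[v0 vS] [M vM]]] [w [[w0 wS] [N wN]]].
exists (fun j => a *: v j + w j); split.
  by split=> [|j]; rewrite ?v0 ?w0// (T_lin (le_subS s j)) vS wS.
exists (`|a| * M + N) => j; apply: le_trans (ler_normD _ _) (lerD _ _) => //.
by rewrite normrZ ler_wpM2l.
Qed.

Lemma stable0 s : stable s 0.
Proof. by exists 0 => j; rewrite (linear_map0 (T_lin (le_addn s j))) normr0. Qed.

Lemma unstable0 s : unstable s 0.
Proof.
exists (fun=> 0); split; last by exists 0 => j; rewrite normr0.
by split=> // j; rewrite (linear_map0 (T_lin (le_subS s j))).
Qed.

(** The forward and backward orbits glue to a bounded homogeneous solution on all integers, which is
    zero by [Tunique]. *)
Lemma stable_unstable0 s x : stable s x -> unstable s x -> x = 0.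
Proof.
move=> [M xM] [v [[v0 vS] [N vN]]].
pose y (n : int) := match n with Posz j => T (s + j%:R) s x | Negz j => v j.+1 end.
suff ys : bounded_solution (lattice_step s T) (fun=> 0) y.
  by have := Tunique ys 0; rewrite /= addr0 T_id.
split.
  exists (M + N) => -[j|j] /=.
    by apply: le_trans (xM j) _; rewrite lerDl (le_trans _ (vN 0%N)).
  by apply: le_trans (vN _) _; rewrite lerDr (le_trans _ (xM 0%N)).
move=> n; rewrite addr0 /lattice_step /lattice.
case: n => [[|j]|j].
- by rewrite /= !addr0 T_id -{1}v0 -vS subr0.
- by rewrite PoszSB1 /= T_comp ?le_addn ?lerD2l ?ler_nat.
- rewrite NegzB1 /= !NegzE !rmorphN; exact/esym/vS.
Qed.

(** With [y] the Green solution for source [x], the stable part is [y 0]. Since [y 0] is the image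
    of [y (-1)] plus [x], the values [- y n] at [n < 0] form a past of [x - y 0]. Decay of [v]
    starts at index 1, as [v 0] is not a value of [- y]. *)
Lemma decomposition s x : exists p v, stable s p /\
  (forall j, `|T (s + j%:R) s p| <= C s * `|x| * z ^+ j) /\
  backward_orbit s (x - p) v /\ (exists M, forall j, `|v j| <= M) /\
  (forall j, `|v j.+1| <= C s * `|x| * z ^+ j.+1).
Proof.
have [y [[[M yM] yE] yC]] := Tgreen s x.
have fwd j : T (s + j%:R) s (y 0) = y (Posz j).
  elim: j => [|j IH]; first by rewrite addr0 T_id.
  rewrite [RHS]yE /= addr0 PoszSB1 -IH /lattice_step /lattice PoszSB1.
  by rewrite T_comp ?le_addn ?lerD2l ?ler_nat.
exists (y 0), (fun j => if j is j'.+1 then - y (Negz j') else x - y 0).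
split; first by exists M => j; rewrite fwd.
split; first by move=> j; rewrite fwd; exact: yC.
split; last split.
- split=> // -[|j].
    rewrite (linear_mapN (T_lin (le_subS s 0%N))) [y 0]yE/= /lattice_step /lattice/=.
    by rewrite addr0 subr0 opprD addrCA subrr addr0 sub0r.
  rewrite (linear_mapN (T_lin (le_subS s j.+1))) [y (Negz j)]yE/= addr0.
  by rewrite /lattice_step /lattice NegzB1 !NegzE !rmorphN.
- exists (`|x - y 0| + M) => -[|j].
    by rewrite lerDl (le_trans _ (yM 0)).
  by rewrite normrN; apply: le_trans (yM _) _; rewrite lerDr.
- by move=> j; rewrite normrN; exact: yC.
Qed.

Lemma decomposition_unique s x p p' : stable s p -> unstable s (x - p) ->
  stable s p' -> unstable s (x - p') -> p = p'.
Proof.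
move=> sp up sp' up'; apply/eqP; rewrite -subr_eq0; apply/eqP.
apply: (@stable_unstable0 s).
  by rewrite addrC -scaleN1r; exact: stable_linear.
have -> : p - p' = (-1) *: (x - p) + (x - p').
  by rewrite scaleN1r opprB addrA subrK.
exact: unstable_linear.
Qed.

(** Boundedness upgrades to decay: by uniqueness a stable vector is its own stable part and inherits
    the Green bound. *)
Lemma stable_decay s x j : stable s x ->
  `|T (s + j%:R) s x| <= C s * `|x| * z ^+ j.
Proof.
move=> sx; have [p [v [sp [pC [vb [vM _]]]]]] := decomposition s x.
suff xp : x = p by rewrite {1}xp; exact: pC.
apply: (@decomposition_unique s x) => //; first by rewrite subrr; exact: unstable0.
by exists v.
Qed.

Lemma unstable_decay s x : unstable s x ->
  exists2 v, backward_orbit s x v & exists M, forall j, `|v j| <= M * z ^+ j.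
Proof.
move=> ux; have [p [v [sp [_ [vb [vM vC]]]]]] := decomposition s x.
have p0 : p = 0.
  apply: (@decomposition_unique s x) => //; first by exists v.
    exact: stable0.
  by rewrite subr0.
exists v; first by rewrite p0 subr0 in vb.
(* The extra [|x|] covers [j = 0], where the Green bound says nothing. *)
exists (C s * `|x| + `|x|) => -[|j].
  by rewrite mulr1 vb.1 p0 subr0 lerDr mulr_ge0.
by apply: le_trans (vC j) _; rewrite ler_wpM2r ?exprn_ge0// lerDl.
Qed.

Let growth_shift (t d : R) (j : nat) : `|d| <= j%:R ->
  expR (nu * `|t + d|) * z ^+ j <= expR (nu * `|t|).
Proof.
move=> dj; rewrite /z -expRM_natl -expRD ler_expR.
have := ler_normD t d; have : 0 <= (gamma - nu) * j%:R by rewrite mulr_ge0// subr_ge0 ltW.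
move=> h1 h2; have : nu * `|t + d| <= nu * (`|t| + j%:R).
  by rewrite ler_wpM2l//; apply: le_trans h2 _; rewrite lerD2l.
nra.
Qed.

(** For a short step, the orbit on the new lattice is one step of [T] away from the old one; the
    step costs [L e^(nu |t + j|)], which the decay [z^j] absorbs because [nu < gamma]. *)
Lemma stable_invariant s t x : s <= t -> stable s x -> stable t (T t s x).
Proof.
move=> st; elim/unit_step_ind: s t / st x => [s t ts x sx|r s t rs st IH1 IH2 x sx];
    last by rewrite -(T_comp x st rs); apply: IH2; exact: IH1.
have st : s <= t by lra.
exists (L * expR (nu * `|t|) * (C s * `|x|)) => j.
have sj : s + j%:R <= t + j%:R by rewrite lerD2r.
rewrite T_comp// -(T_comp x sj (le_addn s j)).
apply: le_trans (TL _ _) _; first by rewrite opprD addrACA subrr addr0.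
apply: le_trans (ler_wpM2l _ (stable_decay j sx)) _.
  by rewrite mulr_ge0 ?expR_ge0.
rewrite [leLHS](_ : _ = L * (C s * `|x|) * (expR (nu * `|t + j%:R|) * z ^+ j)); last by ring.
rewrite [leRHS](_ : _ = L * (C s * `|x|) * expR (nu * `|t|)); last by ring.
by apply: ler_wpM2l; [rewrite !mulr_ge0|apply: growth_shift; rewrite ger0_norm].
Qed.

Lemma unstable_invariant s t x : s <= t -> unstable s x -> unstable t (T t s x).
Proof.
move=> st; elim/unit_step_ind: s t / st x => [s t ts x ux|r s t rs st IH1 IH2 x sx];
    last by rewrite -(T_comp x st rs); apply: IH2; exact: IH1.
have st : s <= t by lra.
have [v [v0 vS] [M vM]] := unstable_decay ux.
have M0 : 0 <= M by have := vM 0%N; rewrite mulr1; exact: le_trans.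
have le j : s - j%:R <= t - j%:R by rewrite lerD2r.
exists (fun j => T (t - j%:R) (s - j%:R) (v j)); split.
  split=> [|j]; first by rewrite !subr0 v0.
  by rewrite -(vS j) !T_comp ?le ?le_subS.
exists (L * M * expR (nu * `|t|)) => j.
apply: le_trans (TL _ _) _; first by rewrite [X in _ <= X <= _](_ : _ = t - s)//; ring.
apply: le_trans (ler_wpM2l _ (vM j)) _; first by rewrite mulr_ge0 ?expR_ge0.
rewrite [leLHS](_ : _ = L * M * (expR (nu * `|t - j%:R|) * z ^+ j)); last by ring.
by apply: ler_wpM2l; [rewrite mulr_ge0|apply: growth_shift; rewrite normrN ger0_norm].
Qed.

(** If a step of length at most 1 kills [x], the forward orbit vanishes from [j = 1] on, so [x] is
    also stable. *)
Lemma unstable_injective s t x : s <= t -> unstable s x -> T t s x = 0 -> x = 0.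
Proof.
move=> st; elim/unit_step_ind: s t / st x => [s t ts x ux Tx|r s t rs st IH1 IH2 x ux Tx]; last first.
  by apply: IH1 => //; apply: IH2; [exact: unstable_invariant|rewrite T_comp].
have st : s <= t by lra.
apply: (@stable_unstable0 s) => //; exists `|x| => -[|j].
  by rewrite addr0 T_id.
have tj : t <= s + j.+1%:R by rewrite -natr1; have : 0 <= j%:R :> R by []; lra.
by rewrite -(T_comp x tj st) Tx (linear_map0 (T_lin tj)) normr0.
Qed.

Lemma unstable_surjective s t y : s <= t -> unstable t y ->
  exists2 x, unstable s x & T t s x = y.
Proof.
move=> st; elim/unit_step_ind: s t / st y => [s t ts y uy|r s t rs st IH1 IH2 y uy]; last first.
  have [x' ux' <-] := IH2 _ uy; have [x ux <-] := IH1 _ ux'.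
  by exists x => //; rewrite T_comp.
have [v [[v0 vS] [M vM]]] := uy.
have t1s : t - 1%:R <= s by rewrite mulr1n; lra.
have st : s <= t by lra.
(* The past of [y] at [t - 1], which precedes [s], is moved forward to [s]. *)
exists (T s (t - 1%:R) (v 1%N)); last first.
  by rewrite T_comp//; have := vS 0%N; rewrite subr0 v0.
apply: unstable_invariant => //; exists (fun j => v j.+1); split.
  by split=> // j; rewrite -!addrA -!opprD -!natrD !add1n; exact: vS.
by exists M.
Qed.

(** [Q] is the unstable component. The Green weight at [s] and the growth weight at [t] combine,
    through [|t| <= |s| + |t - s|], into [e^(2 nu |s|)] and a loss of [nu] in the rate. *)
Lemma lattice_dichotomy (K : R -> R) :
  (forall s, L * c * expR gamma * expR (2 * nu * `|s|) <= K s) ->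
  exists Q : R -> X -> X,
    (forall t, linear_map (Q t) /\ continuous (Q t) /\
               forall x, Q t (Q t x) = Q t x) /\
    (forall t s x, s <= t -> Q t (T t s x) = T t s (Q s x)) /\
    (forall t s y, s <= t -> (exists w, y = Q t w) ->
       exists x, (exists w, x = Q s w) /\ T t s x = y /\
         forall x', (exists w, x' = Q s w) -> T t s x' = y -> x' = x) /\
    (forall t s x, s <= t ->
       `|T t s (x - Q s x)| <= K s * expR (- ((gamma - nu) * (t - s))) * `|x|) /\
    (forall t s x y, t < s -> (exists w, y = Q t w) -> T s t y = Q s x ->
       `|y| <= K s * expR ((gamma - nu) * (t - s)) * `|x|).
Proof.
move=> KL.
have /choice[P PP] : forall sx : R * X, exists p, exists v, stable sx.1 p /\
  (forall j, `|T (sx.1 + j%:R) sx.1 p| <= C sx.1 * `|sx.2| * z ^+ j) /\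
  backward_orbit sx.1 (sx.2 - p) v /\ (exists M, forall j, `|v j| <= M) /\
  (forall j, `|v j.+1| <= C sx.1 * `|sx.2| * z ^+ j.+1).
  by move=> [s x]; exact: decomposition.
pose Q s x := x - P (s, x).
have Ps s x : stable s (P (s, x)) by have [v []] := PP (s, x).
have Qu s x : unstable s (Q s x).
  by have [v [_ [_ [vb [vM _]]]]] := PP (s, x); exists v.
have PE s x p : stable s p -> unstable s (x - p) -> P (s, x) = p.
  by move=> sp up; apply: (@decomposition_unique s x) => //; exact: Qu.
have Quid s x : unstable s x -> Q s x = x.
  move=> ux; rewrite /Q (PE s x 0) ?subr0//; exact: stable0.
have rangeQ s x : (exists w, x = Q s w) <-> unstable s x.
  by split=> [[w ->]|ux]; [exact: Qu|exists x; rewrite Quid].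
have Ql s : linear_map (Q s).
  move=> a x y; rewrite /Q (PE s _ (a *: P (s, x) + P (s, y))).
  - by rewrite scalerBr opprD addrACA.
  - exact: stable_linear.
  - rewrite opprD addrACA -scalerBr; apply: unstable_linear; exact: Qu.
have Pb s x : `|P (s, x)| <= C s * `|x|.
  have [v [_ [/(_ 0%N) + _]]] := PP (s, x).
  by rewrite /= addr0 T_id mulr1.
have inj t s x y : s <= t -> unstable s x -> unstable s y -> T t s x = T t s y -> x = y.
  move=> st ux uy Txy; apply/eqP; rewrite -subr_eq0; apply/eqP.
  apply: (unstable_injective st).
    by rewrite addrC -scaleN1r; exact: unstable_linear.
  by rewrite (linear_mapB (T_lin st)) Txy subrr.
exists Q; split; [|split; [|split; [|split]]].
- move=> t; split=> //; split; last by move=> x; exact: Quid.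
  apply: (@bounded_linear_map_continuous _ _ (Q t) (1 + C t)) => // x.
  by rewrite mulrDl mul1r; apply: le_trans (ler_normB _ _) (lerD _ _).
- move=> t s x st; rewrite /Q (linear_mapB (T_lin st)) (PE t _ (T t s (P (s, x))))//.
    exact: stable_invariant.
  rewrite -(linear_mapB (T_lin st)); apply: unstable_invariant => //; exact: Qu.
- move=> t s y st /rangeQ/(unstable_surjective st)[x ux xy].
  exists x; split; first exact/rangeQ.
  split=> // x' /rangeQ ux' x'y; apply: (inj t s) => //.
  by rewrite xy.
- move=> t s x st; rewrite /Q subKr.
  have [v [_ [/= pC _]]] := PP (s, x).
  (* Rounding [t - s] down replaces [z^(t - s)] by [z^k], at a cost of at most [e^gamma]; the
     remainder is a step of length below 1. *)
  pose k := Num.truncn (t - s).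
  have /andP[k1 k2] : k%:R <= t - s < k.+1%:R by apply: truncn_itv; rewrite subr_ge0.
  have kt : s + k%:R <= t by lra.
  rewrite -(T_comp _ kt (le_addn s k)).
  apply: le_trans (TL _ _) _; first by rewrite -natr1 in k2; lra.
  apply: le_trans (ler_wpM2l _ (pC k)) _; first by rewrite mulr_ge0 ?expR_ge0.
  rewrite [leLHS](_ : _ = L * c * (expR (nu * `|t|) * expR (nu * `|s|) * z ^+ k) * `|x|);
    last by rewrite /C; ring.
  apply: ler_wpM2r => //; apply: le_trans (ler_wpM2r (expR_ge0 _) (KL s)).
  rewrite -!mulrA; apply: ler_wpM2l => //; apply: ler_wpM2l => //.
  rewrite /z -expRM_natl -!expRD ler_expR.
  have : nu * `|t| <= nu * (`|s| + (t - s)).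
    rewrite ler_wpM2l// -{1}(subrK s t) addrC; apply: le_trans (ler_normD _ _) _.
    by rewrite lerD2l ger0_norm// subr_ge0.
  have : gamma * (t - s) <= gamma * k.+1%:R.
    by apply: ler_wpM2l (ltW k2); exact: le_trans nu0 (ltW nugamma).
  rewrite -natr1; nra.
- move=> t s x y ts /rangeQ uy Ty.
  have [v [_ [_ [/= [v0 vS] [vM vC]]]]] := PP (s, x).
  (* Here the lattice time [s - k.+1] must precede [t], and the index [k.+1] is positive, as the
     decay of [v] requires. *)
  pose k := Num.truncn (s - t).
  have /andP[k1 k2] : k%:R <= s - t < k.+1%:R by apply: truncn_itv; rewrite subr_ge0 ltW.
  have kt : s - k.+1%:R <= t by lra.
  have vQ j : T s (s - j%:R) (v j) = Q s x.
    elim: j => [|j IH]; first by rewrite subr0 T_id.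
    by rewrite -IH -(vS j) T_comp ?le_subS ?lerBlDr ?lerDl.
  have vu j : unstable (s - j%:R) (v j).
    have [M vM'] := vM; exists (fun i => v (j + i)%N); split; last by exists M.
    split; first by rewrite addn0.
    by move=> i; have := vS (j + i)%N; rewrite -addnS !natrD !opprD !addrA.
  (* Both sides are unstable at [t] with the same image [Q s x] at [s]. *)
  have yE : y = T t (s - k.+1%:R) (v k.+1).
    apply: (inj s t) => //; first exact: ltW.
      exact: unstable_invariant.
    by rewrite Ty T_comp ?vQ ?(ltW ts).
  rewrite yE; apply: le_trans (TL _ _) _; first by rewrite -natr1 in k2 kt *; lra.
  apply: le_trans (ler_wpM2l _ (vC k)) _; first by rewrite mulr_ge0 ?expR_ge0.
  rewrite [leLHS](_ : _ = L * c * (expR (nu * `|t|) * expR (nu * `|s|) * z ^+ k.+1) * `|x|);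
    last by rewrite /C; ring.
  apply: ler_wpM2r => //; apply: le_trans (ler_wpM2r (expR_ge0 _) (KL s)).
  rewrite -!mulrA; apply: ler_wpM2l => //; apply: ler_wpM2l => //.
  rewrite /z -expRM_natl -!expRD ler_expR.
  have : nu * `|t| <= nu * (`|s| + (s - t)).
    rewrite ler_wpM2l// -{1}(subrK s t) addrC; apply: le_trans (ler_normD _ _) _.
    by rewrite lerD2l ler0_norm ?opprB// subr_le0 ltW.
  have g0 : 0 <= gamma by exact: le_trans nu0 (ltW nugamma).
  have : gamma * (s - t) <= gamma * k.+1%:R by exact: ler_wpM2l (ltW k2).
  nra.
Qed.

End LatticeOrbits.

(** * The perturbed process: growth bound and Green solutions *)

Section Robustness.
Variables (R : realType) (X : completeNormedModType R) (S T : R -> R -> X -> X).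
Variables (D nu alpha z : R).
Hypotheses (Sp : linear_evolution_process S) (Tp : linear_evolution_process T).
Hypotheses (D1 : 1 <= D) (nu0 : 0 <= nu) (nualpha : nu < alpha).
Hypothesis Sd : nonuniform_exp_dichotomy S (fun s => D * expR (nu * `|s|)) alpha.

Let a := expR (- alpha).
Let eps := (z - a) * (1 - a * z) / (1 - a ^+ 2).

Hypotheses (az : a < z) (z1 : z < 1).
Hypothesis ST : forall t s, 0 <= t - s <= 1 ->
  D * expR (nu * `|t|) * opnorm (fun x => S t s x - T t s x) <= eps.

Let D0 : 0 <= D. Proof. exact: le_trans D1. Qed.
Let a0 : 0 < a. Proof. exact: expR_gt0. Qed.

Let diff_linear t s : s <= t -> linear_map (fun x => S t s x - T t s x).
Proof.
move=> st b x y; rewrite (process_linear Sp st) (process_linear Tp st).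
by rewrite scalerBr opprD addrACA.
Qed.

Let diff_continuous t s : s <= t -> continuous (fun x => S t s x - T t s x).
Proof.
by move=> st x; apply: cvgB;
  [exact: process_continuous Sp st x|exact: process_continuous Tp st x].
Qed.

Let diff_bound t s x : 0 <= t - s <= 1 ->
  D * expR (nu * `|t|) * `|S t s x - T t s x| <= eps * `|x|.
Proof.
move=> ts; have st : s <= t by lra.
apply: le_trans (ler_wpM2r (normr_ge0 x) (ST ts)); rewrite -[leRHS]mulrA.
apply: ler_wpM2l; first by rewrite mulr_ge0 ?expR_ge0.
exact: (opnormP (diff_linear st) (diff_continuous st)).
Qed.

Lemma Lset_bounded : has_ubound (Lset S nu) -> has_ubound (Lset T nu).
Proof.
move=> [M SM]; exists (M + eps) => _ [t [s [ts ->]]]; have st : s <= t by lra.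
have Snorm := opnormP (process_linear Sp st) (process_continuous Sp st).
have Bnorm := opnormP (diff_linear st) (diff_continuous st).
set B := opnorm (fun x => _) in Bnorm.
have B0 : 0 <= B by exact: opnorm_ge0.
have : opnorm (T t s) <= opnorm (S t s) + B.
  apply: opnorm_le; first by rewrite addr_ge0 ?opnorm_ge0.
  move=> x; rewrite mulrDl -{1}[T t s x](subKr (S t s x)).
  exact: le_trans (ler_normB _ _) (lerD _ _).
move=> /(ler_wpM2l (expR_ge0 (- (nu * `|t|)))) /le_trans; apply.
rewrite mulrDr lerD//; first by apply: SM; exists t, s.
apply: le_trans (ST ts); rewrite -/B; apply: ler_wpM2r => //.
(* The factor [e^(-nu |t|)] is at most 1 and the weight in [ST] at least 1, so the former can be
   replaced by the latter. *)
have e1 : 1 <= expR (nu * `|t|) by rewrite -expR0 ler_expR mulr_ge0.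
apply: (@le_trans _ _ 1); first by rewrite expR_le1 oppr_le0 mulr_ge0.
by rewrite -[1]mulr1 ler_pM.
Qed.

Lemma L_of_bound : has_ubound (Lset T nu) -> forall t s x, 0 <= t - s <= 1 ->
  `|T t s x| <= L_of T nu * expR (nu * `|t|) * `|x|.
Proof.
move=> Tb t s x ts; have st : s <= t by lra.
apply: le_trans (opnormP (process_linear Tp st) (process_continuous Tp st) x) _.
apply: ler_wpM2r => //; rewrite -ler_pdivrMr ?expR_gt0// -expRN mulrC.
by apply: ub_le_sup => //; exists t, s.
Qed.

(** The identity [T 0 0] has norm at least 1 on a nonzero space. This keeps the final dichotomy
    bound above 1. *)
Lemma L_of_ge1 : (exists x : X, x != 0) -> has_ubound (Lset T nu) ->
  1 <= L_of T nu.
Proof.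
move=> X0 Tb; have [[Tid _] _] := Tp.
apply: le_trans (opnorm_id_ge1 X0 (Tid 0)) _.
apply: ub_le_sup => //; exists 0, 0; rewrite subrr lexx ler01; split=> //.
by rewrite normr0 mulr0 oppr0 expR0 mul1r.
Qed.

Section Lattice.
Variable s : R.

Let A := lattice_step s S.
Let B n x := lattice_step s T n x - lattice_step s S n x.

Let AB : (fun n u => A n u + B n u) = lattice_step s T.
Proof. by apply/funext => n; apply/funext => u; rewrite /A /B addrC subrK. Qed.

Let Aadm := lattice_admissible s Sp D1 nu0 nualpha Sd.

Let Al n : linear_map (A n).
Proof. exact (process_linear Sp (lattice_sub1_le s n)). Qed.

Let Ac n : continuous (A n).
Proof. exact (process_continuous Sp (lattice_sub1_le s n)). Qed.

Let Bl n : linear_map (B n).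
Proof.
move=> b x y; have le := lattice_sub1_le s n.
rewrite /B /lattice_step (process_linear Sp le) (process_linear Tp le).
by rewrite scalerBr opprD addrACA.
Qed.

Let Bc n : continuous (B n).
Proof.
move=> x; have le := lattice_sub1_le s n.
by apply: cvgB; [exact: process_continuous Tp le x|exact: process_continuous Sp le x].
Qed.

Let kB n x : D * expR (nu * `|lattice s n|) * `|B n x| <= eps * `|x|.
Proof.
rewrite /B distrC; apply: diff_bound; rewrite latticeB opprB addrC subrK.
by rewrite ler01 lexx.
Qed.

Lemma lattice_perturbed_unique y :
  bounded_solution (lattice_step s T) (fun=> 0) y -> forall n, y n = 0.
Proof.
rewrite -AB; exact: (perturbation_unique Al a0 az z1 Aadm kB).
Qed.

Lemma lattice_perturbed_green x : exists y,
  bounded_solution (lattice_step s T) (fun n => if n == 0 then x else 0) y /\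
  forall n, `|y n| <= D * ((1 - a ^+ 2) / (1 - z ^+ 2)) * expR (nu * `|s|) *
    `|x| * z ^+ `|n|%N.
Proof.
rewrite -AB; have k0 n : 0 <= D * expR (nu * `|lattice s n|).
  by rewrite mulr_ge0 ?expR_ge0.
have kx : D * expR (nu * `|lattice s 0|) * `|x| <= D * expR (nu * `|s|) * `|x|.
  by rewrite /lattice addr0.
have [|y [ys yb]] := perturbed_solution Al Ac Bl Bc a0 az z1 Aadm k0 kB kx.
  by rewrite !mulr_ge0 ?expR_ge0.
exists y; split=> // n; apply: le_trans (yb n) _.
by rewrite le_eqVlt; apply/orP; left; apply/eqP; ring.
Qed.

End Lattice.
End Robustness.

(** * Scalar estimates for the rate and the bound *)

Section Constants.
Variable R : realType.
Implicit Types (a b z alpha nu : R).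

(** The last condition serves [growth_constant_le]; it is compatible with [a < z] because
    [1 - a (2 - a) = (1 - a)^2 > 0]. *)
Lemma intermediate_rate a b : 0 < a -> a < 1 -> a < b ->
  exists z, [/\ a < z, z < b, z < 1 & z * (2 - a) <= 1].
Proof.
move=> a0 a1 ab; have d0 : 0 < 2 - a by lra.
have am : a < Num.min b (2 - a)^-1.
  rewrite lt_min ab/= -[ltRHS]mul1r ltr_pdivlMr//.
  rewrite -subr_gt0 (_ : 1 - _ = (1 - a) ^+ 2); last by ring.
  by rewrite exprn_gt0// subr_gt0.
have [z1 z2] := midf_lt am; set z := (X in a < X) in z1.
move: z2; rewrite -/z lt_min => /andP[zb zd].
have zd1 : z * (2 - a) < 1 by rewrite -ltr_pdivlMr// mul1r.
exists z; split=> //; last exact: ltW.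
have z0 : 0 < z by exact: lt_trans z1.
by apply: le_lt_trans zd1; rewrite ler_peMr ?ltW//; lra.
Qed.

(** The radicand is the square of [cosh alpha - z], and [cosh alpha >= 1 > z] fixes the sign of its
    root. *)
Lemma rate_root alpha z : 0 < alpha -> expR (- alpha) < z -> z < 1 ->
  cosh alpha - Num.sqrt (cosh alpha ^+ 2 - 1 -
    2 * ((z - expR (- alpha)) * (1 - expR (- alpha) * z) /
         (1 - expR (- alpha) ^+ 2)) * sinh alpha) = z.
Proof.
move=> al0; have a0 : 0 < expR (- alpha) by exact: expR_gt0.
have a1 : expR (- alpha) < 1 by rewrite expR_lt1 oppr_lt0.
have eE : expR alpha = (expR (- alpha))^-1 by rewrite -expRN opprK.
rewrite /cosh /sinh eE.
move: (expR (- alpha)) a0 a1 {eE} => a a0 a1 az z1.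
have a0' : a != 0 by rewrite gt_eqF.
have aa : 1 - a ^+ 2 != 0 by rewrite gt_eqF// subr_gt0 expr_lt1// ltW.
rewrite (_ : _ - 1 - _ = ((a^-1 + a) / 2 - z) ^+ 2); last by field; rewrite a0' aa.
rewrite sqrtr_sqr ger0_norm; first by rewrite subKr.
have : 1 <= (a^-1 + a) / 2.
  rewrite -subr_ge0 (_ : _ - 1 = (1 - a) ^+ 2 / (2 * a)); last by field.
  by rewrite divr_ge0 ?exprn_even_ge0// mulr_ge0// ltW.
lra.
Qed.

(** Bounds the Green constant by [z^-1], which is [e^alpha_t], a factor available in the claimed
    bound. *)
Lemma growth_constant_le a z : 0 < a -> a < z -> z < 1 -> z * (2 - a) <= 1 ->
  (1 - a ^+ 2) / (1 - z ^+ 2) <= z^-1.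
Proof.
move=> a0 az z1 z2; have z0 : 0 < z by exact: lt_trans az.
have zz : 0 < 1 - z ^+ 2 by rewrite subr_gt0 expr_lt1// ltW.
rewrite ler_pdivrMr// [leRHS]mulrC ler_pdivlMr//.
rewrite -subr_ge0 (_ : _ - _ = (1 + z) * (1 - z * (2 - a)) + z * (1 - a) * (z - a));
  last by ring.
by rewrite addr_ge0// !mulr_ge0//; lra.
Qed.

(** This is [D1 >= 1]: after simplification the subtracted term is [a (z - a) / (1 - a^2)], which
    lies in [[0, 1)]. *)
Lemma factor_ge1 a z : 0 < a -> a < z -> z < 1 ->
  1 <= (1 - (z - a) * (1 - a * z) / (1 - a ^+ 2) * a / (1 - a * z))^-1.
Proof.
move=> a0 az z1; have a1 : a < 1 by exact: lt_trans z1.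
have z0 : 0 < z by exact: lt_trans az.
have aa : 0 < 1 - a ^+ 2 by rewrite subr_gt0 expr_lt1// ltW.
have az1 : 0 < 1 - a * z by rewrite subr_gt0 mulr_ilt1// ltW.
rewrite (_ : _ * a / _ = a * (z - a) / (1 - a ^+ 2)); last first.
  by field; rewrite !gt_eqF.
rewrite invf_ge1.
  by rewrite lerBlDr lerDl; apply: divr_ge0 (ltW aa); rewrite mulr_ge0 ?subr_ge0// ltW.
rewrite subr_gt0 ltr_pdivrMr// mul1r -subr_gt0.
rewrite (_ : _ - _ = (1 - a) + a * (1 - z)); last by ring.
by rewrite addr_gt0 ?mulr_gt0 ?subr_gt0.
Qed.

End Constants.

(** * Choice of the threshold and assembly *)

Unset Implicit Arguments.

Theorem mainTheorem7 (R : realType) (X : completeNormedModType R)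
  (S : R -> R -> X -> X) (D nu alpha : R) :
  (exists x : X, x != 0) ->
  linear_evolution_process S ->
  1 <= D -> 0 <= nu -> nu < alpha ->
  nonuniform_exp_dichotomy S (fun s => D * expR (nu * `|s|)) alpha ->
  has_ubound (Lset S nu) ->
  exists eps : R, 0 < eps /\
    forall T : R -> R -> X -> X,
      linear_evolution_process T ->
      (let A := [set r | exists t s : R, 0 <= t - s <= 1 /\
                   r = D * expR (nu * `|t|) *
                       opnorm (fun x => S t s x - T t s x)] in
       has_ubound A /\ sup A < eps) ->
      let alpha_t := - ln (cosh alpha
                       - Num.sqrt (cosh alpha ^+ 2 - 1 - 2 * eps * sinh alpha)) in
      let rho := eps * (1 + expR (- alpha)) / (1 - expR (- alpha)) in
      let beta_t := alpha_t + ln (1 + 2 * eps * sinh alpha) in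
      let D1 := (1 - eps * expR (- alpha) / (1 - expR (- alpha - alpha_t)))^-1 in
      let D2 := (1 - eps * expR (- beta_t) / (1 - expR (- alpha - beta_t)))^-1 in
      let D_t := D * (1 + eps / ((1 - rho) * (1 - expR (- alpha))))
                   * Num.max D1 D2 in
      let LT := L_of T nu in
      has_ubound (Lset T nu) /\
      0 < alpha_t - nu /\
      nonuniform_exp_dichotomy T
        (fun s => D_t ^+ 2 * expR (2 * alpha_t) * Num.max LT (LT ^+ 2)
                  * expR (2 * nu * `|s|))
        (alpha_t - nu).
Proof.
move=> X0 Sp D1 nu0 nualpha Sd SL.
have al0 : 0 < alpha by exact: le_lt_trans nualpha.
have a0 : 0 < expR (- alpha) by exact: expR_gt0.
have a1 : expR (- alpha) < 1 by rewrite expR_lt1 oppr_lt0.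
have anu : expR (- alpha) < expR (- nu) by rewrite ltr_expR ltrN2.
have [z [az znu z1 z2]] := intermediate_rate a0 a1 anu.
have z0 : 0 < z by exact: lt_trans az.
pose a := expR (- alpha).
have aa : 0 < 1 - a ^+ 2 by rewrite subr_gt0 expr_lt1// ltW.
have az1 : 0 < 1 - a * z by rewrite subr_gt0 mulr_ilt1// ltW.
pose eps := (z - a) * (1 - a * z) / (1 - a ^+ 2).
have eps0 : 0 < eps by rewrite divr_gt0// mulr_gt0// subr_gt0.
exists eps; split=> // T Tp [Aub Asup]; rewrite rate_root//.
move=> alpha_t rho beta_t D1' D2 D_t LT.
have zE : expR (- alpha_t) = z by rewrite opprK lnK.
have ST t s : 0 <= t - s <= 1 ->
    D * expR (nu * `|t|) * opnorm (fun x => S t s x - T t s x) <= eps.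
  by move=> ts; apply: le_trans (ltW Asup); apply: ub_le_sup => //; exists t, s.
have TLb := Lset_bounded Sp Tp D1 nu0 ST SL.
have LT1 : 1 <= LT by exact: L_of_ge1.
have nual : nu < alpha_t by rewrite -ltrN2 -ltr_expR zE.
(* The other factors of [D_t] are at least 1: the first because [rho < 1], the maximum because
   [D1' >= 1]. *)
have DD : D <= D_t.
  rewrite /D_t -mulrA ler_peMr ?(le_trans ler01)//.
  have rho1 : rho < 1 by exact: contraction_factor_lt1.
  have D11 : 1 <= D1' by rewrite /D1' expRD zE; exact: factor_ge1.
  apply: mulr_ege1; last by rewrite le_max D11.
  rewrite lerDl; apply: divr_ge0; first exact: ltW.
  by rewrite mulr_ge0 ?subr_ge0// ltW.
have Dt1 : 1 <= D_t by exact: le_trans DD.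
have M1 : 1 <= Num.max LT (LT ^+ 2) by rewrite le_max LT1.
have E1 : 1 <= expR (2 * alpha_t).
  by rewrite -expR0 ler_expR mulr_ge0// (le_trans nu0)// ltW.
pose Khat := D_t ^+ 2 * expR (2 * alpha_t) * Num.max LT (LT ^+ 2).
have Khat1 : 1 <= Khat.
  by apply: mulr_ege1 => //; apply: mulr_ege1 => //; exact: exprn_ege1.
split=> //; split; first by rewrite subr_gt0.
split; first by rewrite subr_gt0.
split.
  move=> s; apply: cvgM; first exact: cvg_cst.
  apply: (@continuous_comp _ _ _ (fun s : R => 2 * nu * `|s|) expR);
    last exact: continuous_expR.
  by apply: cvgM; [exact: cvg_cst|exact: norm_continuous].
split.
  by move=> s; apply: mulr_ege1 => //; rewrite -expR0 ler_expR !mulr_ge0.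
split; first by exists Khat, (2 * nu); rewrite mulr_ge0.
have c0 : 0 <= D * ((1 - a ^+ 2) / (1 - z ^+ 2)).
  apply: mulr_ge0; first exact: le_trans D1.
  by apply: divr_ge0 (ltW aa) _; rewrite subr_ge0 exprn_ile1// ltW.
apply: (@lattice_dichotomy _ _ T nu alpha_t
  (D * ((1 - a ^+ 2) / (1 - z ^+ 2))) LT) => //.
- by rewrite (le_trans ler01).
- exact: L_of_bound.
- by move=> s y; exact: (lattice_perturbed_unique Sp Tp D1 nu0 nualpha Sd az z1 ST).
- by move=> s x; rewrite zE; exact: (lattice_perturbed_green Sp Tp D1 nu0 nualpha Sd az z1 ST).
- move=> s; apply: ler_wpM2r; first exact: expR_ge0.
  (* One of the two factors [e^alpha_t] in the claimed bound absorbs the Green constant; the other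
     pays for rounding to the lattice. *)
  have cD : D * ((1 - a ^+ 2) / (1 - z ^+ 2)) <= D_t ^+ 2 * expR alpha_t.
    apply: ler_pM.
    + by rewrite (le_trans ler01).
    + by rewrite divr_ge0 ?(ltW aa)// subr_ge0 exprn_ile1// ltW.
    + by apply: le_trans DD _; rewrite expr2 ler_peMr// (le_trans ler01).
    + by rewrite -[alpha_t]opprK expRN zE; exact: growth_constant_le.
  have eE : expR (2 * alpha_t) = expR alpha_t * expR alpha_t.
    by rewrite -expRD; congr expR; ring.
  rewrite eE [D_t ^+ 2 * _]mulrA [leRHS]mulrC -[leLHS]mulrA; apply: ler_pM.
  + exact: le_trans ler01 LT1.
  + by rewrite mulr_ge0 ?expR_ge0.
  + by rewrite le_max lexx.
  + by apply: ler_wpM2r cD; exact: expR_ge0.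
Qed.
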